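(* Let $(H,R)$ be a quasitriangular Hopf algebra such that $H$ is generated as an algebra by $\{a_i\mid 1\le i\le n\}$. Suppose that (i) $G(H)\cap Z(H)=\{1\}$; (ii) $S^2(a_i)=\lambda_ia_i$ for all $1\le i\le n$, where each $\lambda_i\in\Bbbk$ is a root of unity of odd order. Then there is a unique ribbon element for $(H,R)$.
   Context: All Hopf algebras are finite-dimensional over an algebraically closed field $\Bbbk$ of characteristic $0$. $G(H)$ is the group of group-like elements, $Z(H)$ the center, $S$ the antipode of $H$. A quasitriangular Hopf algebra is $(H,R)$ with $R\in H\otimes H$ invertible, $(\Delta\otimes\mathrm{Id})(R)=R_{13}R_{23}$, $(\mathrm{Id}\otimes\Delta)(R)=R_{13}R_{12}$, $\Delta^{op}(h)R=R\Delta(h)$. Writing $R=\sum_iR_i\otimes R^i$, put $u=\sum_iS(R^i)R_i$. A ribbon element of $(H,R)$ is a central element $v\in H$ with $v^2=uS(u)$, $S(v)=v$, $\epsilon(v)=1$, $\Delta(v)=(v\otimes v)(R_{21}R)^{-1}$. *)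

(* Defs.v *)
From HB Require Import structures.
From mathcomp Require Export all_boot all_algebra all_field.

Set Implicit Arguments.
Unset Strict Implicit.
Unset Printing Implicit Defensive.

Import GRing.Theory.
Local Open Scope ring_scope.

Reserved Notation "u *t v" (at level 40, left associativity).

(* The tensor product of finite-dimensional spaces, encoded by coordinates in
   the bases vbasis {:U} and vbasis {:V}.  The encoding is irrelevant:
   tens_bilinear, tlift_tens and tlift_unique give the universal property. *)
Definition tensor (k : fieldType) (U V : vectType k) : Type :=
  'M[k]_(\dim {:U}, \dim {:V}).

HB.instance Definition _ (k : fieldType) (U V : vectType k) :=
  Vector.copy (tensor U V) 'M[k]_(\dim {:U}, \dim {:V}).

Definition bilinear2 (k : fieldType) (U V W : lmodType k) (f : U -> V -> W) :=
  (forall v, linear (f^~ v)) /\ (forall u, linear (f u)).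

Section Tensor.
Variables (k : fieldType) (U V : vectType k).

Definition tens (u : U) (v : V) : tensor U V :=
  \matrix_(i, j) (coord (vbasis {:U}) i u * coord (vbasis {:V}) j v).

(* The linear map U (x) V -> W induced by a bilinear f; meaningless when f is
   not bilinear. *)
Definition tlift (W : lmodType k) (f : U -> V -> W) (t : tensor U V) : W :=
  \sum_i \sum_j t i j *: f (vbasis {:U})`_i (vbasis {:V})`_j.

End Tensor.

Notation "u *t v" := (tens u v) : ring_scope.

Section TensorTheory.
Variables (k : fieldType) (U V : vectType k).
Implicit Types (u : U) (v : V) (W : lmodType k).

Lemma tens_bilinear : bilinear2 (@tens k U V).
Proof.
split=> [v|u] c x y; apply/matrixP=> i j; rewrite !mxE linearP /=.
  by rewrite mulrDl mulrA.
by rewrite mulrDr mulrCA.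
Qed.

Lemma tensDl u u' v : (u + u') *t v = u *t v + u' *t v.
Proof. by have := tens_bilinear.1 v 1 u u'; rewrite !scale1r. Qed.

Lemma tensDr u v v' : u *t (v + v') = u *t v + u *t v'.
Proof. by have := tens_bilinear.2 u 1 v v'; rewrite !scale1r. Qed.

Lemma tensZl c u v : (c *: u) *t v = c *: (u *t v).
Proof. by apply/matrixP=> i j; rewrite !mxE linearZ /= mulrA. Qed.

Lemma tensZr c u v : u *t (c *: v) = c *: (u *t v).
Proof. by apply/matrixP=> i j; rewrite !mxE linearZ /= mulrCA. Qed.

Lemma tens_neq0 u v : u != 0 -> v != 0 -> u *t v != 0.
Proof.
have coord0 (T : vectType k) (x : T) : x != 0 ->
    exists i, coord (vbasis {:T}) i x != 0.
  move=> x0; apply/existsP; apply: contraNT x0; rewrite negb_exists.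
  move/forallP=> x0; rewrite (coord_vbasis (memvf x)) big1 // => i _.
  by have := x0 i; rewrite negbK => /eqP->; rewrite scale0r.
move=> /coord0[i ui] /coord0[j vj]; apply/eqP=> /matrixP/(_ i j)/eqP.
by rewrite !mxE mulf_eq0 (negPf ui) (negPf vj).
Qed.

Lemma tlift_is_linear W (f : U -> V -> W) : linear (tlift f).
Proof.
move=> c s t; rewrite /tlift scaler_sumr -big_split; apply: eq_bigr => i _.
rewrite scaler_sumr -big_split; apply: eq_bigr => j _ /=.
by rewrite !mxE scalerDl scalerA.
Qed.

HB.instance Definition _ W (f : U -> V -> W) :=
  GRing.isLinear.Build k (tensor U V) W _ (tlift f) (tlift_is_linear f).

Lemma tlift_addf W (f g h : U -> V -> W) t :
  (forall u v, h u v = f u v + g u v) -> tlift h t = tlift f t + tlift g t.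
Proof.
move=> hE; rewrite /tlift -big_split; apply: eq_bigr => i _.
by rewrite -big_split; apply: eq_bigr => j _; rewrite hE scalerDr.
Qed.

Lemma tlift_tens W (f : U -> V -> W) u v :
  bilinear2 f -> tlift f (u *t v) = f u v.
Proof.
case=> fl fr.
have fls w (I : finType) (c : I -> k) (x : I -> U) :
    f (\sum_i c i *: x i) w = \sum_i c i *: f (x i) w.
  pose g := HB.pack_for {linear U -> W} (f^~ w)
    (GRing.isLinear.Build k U W _ (f^~ w) (fl w)).
  rewrite -[LHS]/(g _) linear_sum; apply: eq_bigr => i _.
  exact: (linearZ_LR g).
have frs w (I : finType) (c : I -> k) (x : I -> V) :
    f w (\sum_i c i *: x i) = \sum_i c i *: f w (x i).
  pose g := HB.pack_for {linear V -> W} (f w)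
    (GRing.isLinear.Build k V W _ (f w) (fr w)).
  rewrite -[LHS]/(g _) linear_sum; apply: eq_bigr => i _.
  exact: (linearZ_LR g).
rewrite {2}(coord_vbasis (memvf u)) fls; apply: eq_bigr => i _.
rewrite {2}(coord_vbasis (memvf v)) frs scaler_sumr; apply: eq_bigr => j _.
by rewrite !mxE scalerA.
Qed.

Lemma tens_basis (t : tensor U V) : t = tlift (@tens k U V) t.
Proof.
have fV (T : vectType k) (i : 'I_(\dim {:T})) j :
    coord (vbasis {:T}) j (vbasis {:T})`_i = (i == j)%:R.
  by rewrite coord_free ?(basis_free (vbasisP _)).
apply/matrixP=> i j; rewrite summxE (bigD1 i) //= summxE (bigD1 j) //=.
rewrite !mxE !fV !eqxx !mulr1 !big1 ?addr0 // => i' ni.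
  by rewrite summxE big1 // => j' _; rewrite !mxE !fV (negPf ni) mul0r mulr0.
by rewrite !mxE !fV (negPf ni) !mulr0.
Qed.

Lemma tensor_ind (P : tensor U V -> Prop) :
    (forall u v, P (u *t v)) -> (forall s t, P s -> P t -> P (s + t)) ->
  forall t, P t.
Proof.
move=> Pt PD t; rewrite (tens_basis t).
have P0 : P 0 by have := Pt 0 0; have := tensZl 0 0 0; rewrite !scale0r => ->.
rewrite /tlift; apply: big_ind => // i _; apply: big_ind => // j _.
by rewrite -tensZl; exact: Pt.
Qed.

Lemma tlift_unique W (f : U -> V -> W) (g : {linear tensor U V -> W}) :
  (forall u v, g (u *t v) = f u v) -> g =1 tlift f.
Proof.
move=> gf t; rewrite {1}(tens_basis t) linear_sum; apply: eq_bigr => i _.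
by rewrite linear_sum; apply: eq_bigr => j _; rewrite linearZ_LR gf.
Qed.

End TensorTheory.

Section TensorMaps.
Variable k : fieldType.

Definition tmap (U V U' V' : vectType k) (f : U -> U') (g : V -> V') :
    tensor U V -> tensor U' V' :=
  tlift (fun u v => f u *t g v).

Definition tflip (U V : vectType k) : tensor U V -> tensor V U :=
  tlift (fun u v => v *t u).

Definition tassoc (U V W : vectType k) :
    tensor U (tensor V W) -> tensor (tensor U V) W :=
  tlift (fun u => tlift (fun v w => (u *t v) *t w)).

End TensorMaps.

Section TensorAlgebra.
Variables (k : fieldType) (A B : falgType k).
Implicit Types (r s t : tensor A B) (a : A) (b : B).

Definition tmul s t : tensor A B :=
  tlift (fun a b => tlift (fun a' b' => (a * a') *t (b * b')) t) s.

Lemma tmul_inner_bilinear a b :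
  bilinear2 (fun a' b' => (a * a') *t (b * b') : tensor A B).
Proof.
by split=> [y|y] c x z; rewrite mulrDr -scalerAr ?tensDl ?tensDr ?tensZl ?tensZr.
Qed.

Lemma tmul_outer_bilinear t :
  bilinear2 (fun a b => tlift (fun a' b' => (a * a') *t (b * b')) t : tensor A B).
Proof.
split=> y c x z; rewrite /tlift scaler_sumr -big_split /=; apply: eq_bigr => i _;
  rewrite scaler_sumr -big_split /=; apply: eq_bigr => j _;
  rewrite mulrDl -scalerAl ?tensDl ?tensDr ?tensZl ?tensZr scalerDr;
  by rewrite !scalerA [c * _]mulrC.
Qed.

Lemma tmulE a b a' b' : tmul (a *t b) (a' *t b') = (a * a') *t (b * b').
Proof.
rewrite /tmul tlift_tens; last exact: tmul_outer_bilinear.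
by rewrite tlift_tens //; exact: tmul_inner_bilinear.
Qed.

Lemma tmulDl : left_distributive tmul +%R.
Proof. by move=> r s t; rewrite /tmul linearD. Qed.

Lemma tmulDr : right_distributive tmul +%R.
Proof.
by move=> r s t; apply: tlift_addf => a b; exact: linearD.
Qed.

Lemma tmulA : associative tmul.
Proof.
move=> r s t.
elim/tensor_ind: r => [a b|r r' IH IH']; last by rewrite !tmulDl IH IH'.
elim/tensor_ind: s => [a' b'|s s' IH IH']; last by rewrite tmulDr !tmulDl tmulDr IH IH'.
elim/tensor_ind: t => [a'' b''|t t' IH IH']; last by rewrite !tmulDr IH IH'.
by rewrite !tmulE !mulrA.
Qed.

Lemma tmul1l : left_id (1 *t 1) tmul.
Proof.
by elim/tensor_ind=> [a b|s t IHs IHt]; rewrite ?tmulE ?mul1r // tmulDr IHs IHt.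
Qed.

Lemma tmul1r : right_id (1 *t 1) tmul.
Proof.
by elim/tensor_ind=> [a b|s t IHs IHt]; rewrite ?tmulE ?mulr1 // tmulDl IHs IHt.
Qed.

Lemma tone_neq0 : (1 : A) *t (1 : B) != 0.
Proof. by apply: tens_neq0; exact: oner_neq0. Qed.

HB.instance Definition _ := GRing.Zmodule_isNzRing.Build (tensor A B)
  tmulA tmul1l tmul1r tmulDl tmulDr tone_neq0.

Lemma tensM a b a' b' :
  (a *t b) * (a' *t b') = (a * a') *t (b * b') :> tensor A B.
Proof. exact: tmulE. Qed.

Lemma tens1 : (1 : A) *t (1 : B) = 1 :> tensor A B.
Proof. by []. Qed.

Lemma tscalerAl c s t : c *: (s * t) = (c *: s) * t :> tensor A B.
Proof. by rewrite [in RHS]/GRing.mul /= /tmul linearZ. Qed.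

Lemma tscalerAr c s t : c *: (s * t) = s * (c *: t) :> tensor A B.
Proof.
elim/tensor_ind: s => [a b|s s' IH IH']; last by rewrite !mulrDl scalerDr IH IH'.
elim/tensor_ind: t => [a' b'|t t' IH IH'].
  by rewrite -tensZl !tensM -tensZl -scalerAr.
by rewrite scalerDr !mulrDr scalerDr IH IH'.
Qed.

HB.instance Definition _ :=
  GRing.Lmodule_isLalgebra.Build k (tensor A B) tscalerAl.
HB.instance Definition _ :=
  GRing.Lalgebra_isAlgebra.Build k (tensor A B) tscalerAr.
HB.instance Definition _ := Algebra_isFalgebra.Build k (tensor A B).

End TensorAlgebra.

HB.mixin Record Falgebra_isHopf (k : fieldType) H of Falgebra k H := {
  comul : {lrmorphism H -> tensor H H};
  counit : {lrmorphism H -> k^o};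
  antipode : {linear H -> H};
  coassoc : forall h : H,
    tassoc (tmap idfun comul (comul h)) = tmap comul idfun (comul h);
  counitl : forall h : H, tlift (fun x y => counit x *: y) (comul h) = h;
  counitr : forall h : H, tlift (fun x y => counit y *: x) (comul h) = h;
  antipodel : forall h : H,
    tlift (fun x y => antipode x * y) (comul h) = (counit h)%:A;
  antipoder : forall h : H,
    tlift (fun x y => x * antipode y) (comul h) = (counit h)%:A
}.

#[short(type="hopfAlgType")]
HB.structure Definition HopfAlgebra (k : fieldType) :=
  { H of Falgebra_isHopf k H & Falgebra k H }.

Section Quasitriangular.
Variables (k : fieldType) (H : hopfAlgType k).
Implicit Types (R : tensor H H) (g v : H).

Definition grouplike g : Prop := g != 0 /\ comul g = g *t g.

Definition central v : Prop := v \in 'Z({:H})%VS.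

Definition leg12 R : tensor (tensor H H) H := R *t 1.

Definition leg13 R : tensor (tensor H H) H := tlift (fun x y => (x *t 1) *t y) R.

Definition leg23 R : tensor (tensor H H) H := tlift (fun x y => (1 *t x) *t y) R.

Record quasitriangular R : Prop := {
  Rmatrix_unit : R \is a GRing.unit;
  Rmatrix_comull : tmap comul idfun R = leg13 R * leg23 R;
  Rmatrix_comulr : tassoc (tmap idfun comul R) = leg13 R * leg12 R;
  Rmatrix_op : forall h : H, tflip (comul h) * R = R * comul h
}.

Definition drinfeld R : H := tlift (fun x y => antipode y * x) R.

Record ribbon R v : Prop := {
  ribbon_central : central v;
  ribbon_sqr : v ^+ 2 = drinfeld R * antipode (drinfeld R);
  ribbon_antipode : antipode v = v;
  ribbon_counit : counit v = 1;
  ribbon_comul : comul v = (v *t v) * (tflip R * R)^-1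
}.

End Quasitriangular.

(* Main.v *)
From HB Require Import structures.
Require Import Defs.

Set Implicit Arguments.
Unset Strict Implicit.
Unset Printing Implicit Defensive.

Import GRing.Theory.
Local Open Scope ring_scope.

(** Ribbon elements come from square roots of a certain group-like element [g],
    and an element of odd order is a square in the cyclic group it generates.

    Let [u] be the Drinfeld element of [(H, R)].  It is invertible, it
    implements the square of the antipode, [u h = S^2(h) u] ([mul_drinfeld],
    [drinfeld_unit]), and [Delta(u) = (u (x) u) (R21 R)^-1] ([comul_drinfeld]).
    Applying [S] to these facts shows that [g = S(u)^-1 u] is group-like and
    that it implements [S^4] ([drinfeld_grouplikeP], [mul_drinfeld_grouplike]).
    If [l] is group-like, [l^2 = g], and [l] already implements [S^2], then
    [v = l^-1 u] is central, and the formulas for [u] turn into the axioms of a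
    ribbon element ([ribbon_of_sqrt]).

    The hypotheses provide [l].  Since [g a_i = lambda_i^2 a_i g], for a common
    odd period [N] of the [lambda_i] the element [g^N] commutes with the
    generators, so it is central and group-like, hence [g^N = 1].  Put
    [l = g^((N+1)/2)].  Then [l^2 = g^(N+1) = g], and
    [l a_i = lambda_i^(N+1) a_i l = lambda_i a_i l], so conjugation by [l]
    agrees with [S^2] on the generators.

    For uniqueness, the factors [(R21 R)^-1] cancel in the coproduct of the
    quotient of two ribbon elements, so this quotient is a central group-like
    element ([ribbon_unique]).

    Sweedler sums are written [tlift f (comul h)], with [f] multilinear;
    identities involving an arbitrary tensor [t] are reduced to pure tensors by
    linearity in [t].  The antipode is handled through the convolution product:
    an inverse for convolution is unique. *)

(** * Linear calculus on tensor products *)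

Section LinearMaps.
Variables (k : fieldType) (W W' : lmodType k) (g : W -> W').
Hypothesis gl : linear g.

Lemma linear_map0 : g 0 = 0.
Proof. by have := gl (-1) 0 0; rewrite scaler0 addr0 scaleN1r addNr. Qed.

Lemma linear_mapZ c x : g (c *: x) = c *: g x.
Proof. by have := gl c x 0; rewrite linear_map0 !addr0. Qed.

Lemma linear_mapD x y : g (x + y) = g x + g y.
Proof. by have := gl 1 x y; rewrite !scale1r. Qed.

End LinearMaps.

Section TensorExtensionality.
Variables (k : fieldType) (U V : vectType k) (W : lmodType k).

Lemma tensor_eq (f g : tensor U V -> W) :
  linear f -> linear g -> (forall u v, f (u *t v) = g (u *t v)) -> f =1 g.
Proof.
move=> fl gl fg; elim/tensor_ind=> // s t fs ft.
by rewrite (linear_mapD fl) (linear_mapD gl) fs ft.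
Qed.

Lemma eq_tlift (f g : U -> V -> W) : f =2 g -> tlift f =1 tlift g.
Proof.
by move=> fg t; apply: eq_bigr => i _; apply: eq_bigr => j _; rewrite fg.
Qed.

Lemma tlift_comb c (f g h : U -> V -> W) t :
    (forall u v, h u v = c *: f u v + g u v) ->
  tlift h t = c *: tlift f t + tlift g t.
Proof.
move=> hE; rewrite /tlift scaler_sumr -big_split; apply: eq_bigr => i _ /=.
rewrite scaler_sumr -big_split; apply: eq_bigr => j _ /=.
by rewrite hE scalerDr !scalerA mulrC.
Qed.

Lemma tlift_comp (W' : lmodType k) (g : W -> W') (f : U -> V -> W) t :
  linear g -> g (tlift f t) = tlift (fun u v => g (f u v)) t.
Proof.
move=> gl; have g0 := linear_map0 gl; have gD := linear_mapD gl.
rewrite /tlift (big_morph g gD g0); apply: eq_bigr => i _.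
by rewrite (big_morph g gD g0); apply: eq_bigr => j _; rewrite (linear_mapZ gl).
Qed.

End TensorExtensionality.

Definition trilinear (k : fieldType) (U V W X : lmodType k)
    (f : U -> V -> W -> X) :=
  [/\ forall y z, linear (fun x => f x y z),
      forall x z, linear (fun y => f x y z) & forall x y, linear (f x y)].

(** Used to multiply together, or to apply antipodes to, the legs of an identity
    between elements of a triple tensor product. *)
Definition tlift3 (k : fieldType) (U V W : vectType k) (X : lmodType k)
    (f : U -> V -> W -> X) : tensor (tensor U V) W -> X :=
  tlift (fun s z => tlift (fun x y => f x y z) s).

(** Compatibility of each operation with combinations [c *: x + y], always
    normalized to the same shape, so that rewriting with all of them proves that
    a map composed of these operations is linear. *)
Section Combinations.
Variables (k : fieldType).
Implicit Type c : k.

Lemma tens_combl (U V : vectType k) c (x y : U) (z : V) :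
  (c *: x + y) *t z = c *: (x *t z) + y *t z.
Proof. by rewrite tensDl tensZl. Qed.

Lemma tens_combr (U V : vectType k) c (z : U) (x y : V) :
  z *t (c *: x + y) = c *: (z *t x) + z *t y.
Proof. by rewrite tensDr tensZr. Qed.

Lemma mul_combl (A : falgType k) c (x y z : A) :
  (c *: x + y) * z = c *: (x * z) + y * z.
Proof. by rewrite mulrDl scalerAl. Qed.

Lemma mul_combr (A : falgType k) c (x y z : A) :
  z * (c *: x + y) = c *: (z * x) + z * y.
Proof. by rewrite mulrDr scalerAr. Qed.

Lemma scale_combl (W : lmodType k) c a b (x : W) :
  (c * a + b) *: x = c *: (a *: x) + b *: x.
Proof. by rewrite scalerDl scalerA. Qed.

Lemma scale_combr (W : lmodType k) c a (x y : W) :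
  a *: (c *: x + y) = c *: (a *: x) + a *: y.
Proof. by rewrite scalerDr !scalerA mulrC. Qed.

Lemma tlift_combr (U V : vectType k) (W : lmodType k) (f : U -> V -> W) c s t :
  tlift f (c *: s + t) = c *: tlift f s + tlift f t.
Proof. exact: linearP. Qed.

Lemma tlift3_comb (U V W : vectType k) (X : lmodType k)
    (f : U -> V -> W -> X) c s t :
  tlift3 f (c *: s + t) = c *: tlift3 f s + tlift3 f t.
Proof. exact: tlift_combr. Qed.

Lemma tmap_comb (U V U' V' : vectType k) (f : U -> U') (g : V -> V') c s t :
  tmap f g (c *: s + t) = c *: tmap f g s + tmap f g t.
Proof. exact: tlift_combr. Qed.

Lemma tflip_comb (U V : vectType k) c (s t : tensor U V) :
  tflip (c *: s + t) = c *: tflip s + tflip t.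
Proof. exact: tlift_combr. Qed.

Lemma tassoc_comb (U V W : vectType k) c (s t : tensor U (tensor V W)) :
  tassoc (c *: s + t) = c *: tassoc s + tassoc t.
Proof. exact: tlift_combr. Qed.

Variable H : hopfAlgType k.
Implicit Types (x y : H) (s t : tensor H H).

Lemma leg12_comb c s t : leg12 (c *: s + t) = c *: leg12 s + leg12 t.
Proof. exact: tens_combl. Qed.

Lemma leg13_comb c s t : leg13 (c *: s + t) = c *: leg13 s + leg13 t.
Proof. exact: tlift_combr. Qed.

Lemma leg23_comb c s t : leg23 (c *: s + t) = c *: leg23 s + leg23 t.
Proof. exact: tlift_combr. Qed.

Lemma comul_comb c x y : comul (c *: x + y) = c *: comul x + comul y.
Proof. exact: linearP. Qed.

Lemma counit_comb c x y : counit (c *: x + y) = c * counit x + counit y :> k.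
Proof. by rewrite linearP. Qed.

Lemma antipode_comb c x y :
  antipode (c *: x + y) = c *: antipode x + antipode y.
Proof. exact: linearP. Qed.

End Combinations.

Definition combE := (tens_combl, tens_combr, mul_combl, mul_combr, scale_combl,
  scale_combr, tlift_combr, tlift3_comb, tmap_comb, tflip_comb, tassoc_comb,
  leg12_comb, leg13_comb, leg23_comb, comul_comb, counit_comb, antipode_comb).

Ltac lincomb := cbv beta;
  match goal with
  | |- tlift _ _ = _ *: tlift _ ?t + tlift _ ?t =>
      apply: tlift_comb => ? ?; lincomb
  | _ => by rewrite ?combE /=
  end.

(* Unification must not compare tensors by unfolding them to matrices of
   coordinates: terms explode, and a failed rewrite then hardly terminates. *)
#[local] Opaque tens tlift.

Ltac lin := move=> ? ? ?; lincomb.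
Ltac bilin := split=> ?; lin.
Ltac trilin := split=> ? ?; lin.

(* Proves an equation between two expressions linear in [t] from the case where
   [t] is a pure tensor. *)
Ltac tensor_ext t :=
  pattern t;
  match goal with |- (fun x => @eq _ (@?f x) (@?g x)) _ =>
    refine (@tensor_eq _ _ _ _ f g _ _ _ t); [lin | lin | cbv beta]
  end.

Section TensorMapTheory.
Variables (k : fieldType) (U V Z U' V' : vectType k) (X : lmodType k).

HB.instance Definition _ :=
  GRing.isLinear.Build k _ _ _ (@tflip k U V) (tlift_is_linear _).

Lemma tmapE (f : {linear U -> U'}) (g : {linear V -> V'}) u v :
  tmap f g (u *t v) = f u *t g v.
Proof. by apply: tlift_tens; split=> w c x y; rewrite linearP ?combE. Qed.

Lemma tlift_tmap (W : lmodType k) (f : U' -> V' -> W) (g : {linear U -> U'})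
    (h : {linear V -> V'}) t :
  bilinear2 f -> tlift f (tmap g h t) = tlift (fun x y => f (g x) (h y)) t.
Proof.
move=> f2; have [fl fr] := f2; tensor_ext t => x y; rewrite tmapE !tlift_tens //.
by split=> z c a b; rewrite linearP ?fl ?fr.
Qed.

Lemma tflipE (u : U) (v : V) : tflip (u *t v) = v *t u.
Proof. by apply: tlift_tens; bilin. Qed.

Lemma tassocE (u : U) (v : V) (w : Z) : tassoc (u *t (v *t w)) = (u *t v) *t w.
Proof. by rewrite /tassoc tlift_tens ?tlift_tens //; bilin. Qed.

Lemma tlift3E (f : U -> V -> Z -> X) s z :
  trilinear f -> tlift3 f (s *t z) = tlift (fun x y => f x y z) s.
Proof.
case=> f1 f2 f3; apply: tlift_tens.
by split=> y c u v; [rewrite linearP | apply: tlift_comb => ? ?; exact: f3].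
Qed.

Lemma tlift3_tassoc (f : U -> V -> Z -> X) x t :
  trilinear f -> tlift3 f (tassoc (x *t t)) = tlift (f x) t.
Proof.
move=> f3; have [fx fy fz] := f3; tensor_ext t => y z.
by rewrite tassocE tlift3E // !tlift_tens //; split=> // u; exact: fz.
Qed.

End TensorMapTheory.

(** * The convolution product *)

Section Convolution.
Variables (k : fieldType) (H : hopfAlgType k).
Implicit Types h : H.

(** Coassociativity in Sweedler form: [h1 (x) h21 (x) h22] against
    [h11 (x) h12 (x) h2]. *)
Lemma sweedlerA (W : lmodType k) (f : H -> H -> H -> W) h : trilinear f ->
  tlift (fun x y => tlift (f x) (comul y)) (comul h) =
  tlift (fun x z => tlift (fun x y => f x y z) (comul x)) (comul h).
Proof.
move=> f3; have [fx fy fz] := f3.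
have El t : tlift3 f (tmap comul idfun t) =
    tlift (fun x z => tlift (fun x y => f x y z) (comul x)) t.
  tensor_ext t => x z; rewrite tmapE tlift3E //.
  rewrite tlift_tens //; split=> [w|w] c u v; first by rewrite !linearP.
  by apply: tlift_comb => ? ?; exact: fz.
have Er t : tlift3 f (tassoc (tmap idfun comul t)) =
    tlift (fun x y => tlift (f x) (comul y)) t.
  tensor_ext t => x y; rewrite tmapE tlift3_tassoc //.
  rewrite tlift_tens //; split=> [w|w] c u v; last by rewrite !linearP.
  by apply: tlift_comb => ? ?; exact: fx.
by rewrite -El -Er coassoc.
Qed.

Definition conv (A : falgType k) (f g : H -> A) h : A :=
  tlift (fun x y => f x * g y) (comul h).

Lemma conv_linear (A : falgType k) (f g : H -> A) : linear (conv f g).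
Proof. by move=> c u v; rewrite /conv !linearP. Qed.

Lemma eq_conv (A : falgType k) (f f' g g' : H -> A) :
  f =1 f' -> g =1 g' -> conv f g =1 conv f' g'.
Proof. by move=> ff gg h; apply: eq_tlift => x y; rewrite ff gg. Qed.

Lemma convA (A : falgType k) (f g e : H -> A) :
  linear f -> linear g -> linear e -> conv f (conv g e) =1 conv (conv f g) e.
Proof.
move=> fl gl el h.
transitivity (tlift (fun x y => tlift (fun y z => f x * g y * e z) (comul y))
                (comul h)).
  apply: eq_tlift => x y; rewrite /conv tlift_comp; last by lin.
  by apply: eq_tlift => ? ?; rewrite mulrA.
rewrite sweedlerA; last by split=> y z c u v; rewrite ?fl ?gl ?el; lincomb.
apply: eq_tlift => x z.
by rewrite /conv [RHS](@tlift_comp _ _ _ _ _ (fun a => a * e z)) //; lin.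
Qed.

Lemma conv_counitl (A : falgType k) (a : A) (e : H -> A) :
  linear e -> conv (fun h => (counit h : k) *: a) e =1 fun h => a * e h.
Proof.
move=> el h; rewrite -[in RHS](counitl h) tlift_comp // tlift_comp; last by lin.
by apply: eq_tlift => x y; rewrite (linear_mapZ el) -scalerAl scalerAr.
Qed.

Lemma conv_counitr (A : falgType k) (a : A) (e : H -> A) :
  linear e -> conv e (fun h => (counit h : k) *: a) =1 fun h => e h * a.
Proof.
move=> el h; rewrite -[in RHS](counitr h) tlift_comp //.
rewrite (@tlift_comp _ _ _ _ _ (fun b => b * a)); last by lin.
by apply: eq_tlift => x y; rewrite (linear_mapZ el) -scalerAr scalerAl.
Qed.

(** Right division: an equation [f * g = p] is solved by [f = p * e] when [e] is
    a right convolution inverse of [g].  This gives the behaviour of the antipode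
    on products and its coproduct. *)
Lemma conv_div (A : falgType k) (f g e p : H -> A) :
    linear f -> linear g -> linear e -> conv f g =1 p ->
    conv g e =1 (fun h => (counit h : k)%:A) ->
  f =1 conv p e.
Proof.
move=> fl gl el fg ge h; rewrite -[LHS]mulr1 -(conv_counitr 1 fl).
by rewrite -(eq_conv (frefl f) ge) convA //; exact: eq_conv.
Qed.

End Convolution.

(** * The antipode *)

Section AntipodeTheory.
Variables (k : fieldType) (H : hopfAlgType k).
Implicit Types x y h : H.

Lemma conv_antipoder : conv id antipode =1 fun h : H => (counit h : k)%:A.
Proof. exact: antipoder. Qed.

Lemma counitM x y : counit (x * y) = counit x * counit y :> k.
Proof. exact: rmorphM. Qed.

Lemma comulM x y : comul (x * y) = comul x * comul y.
Proof. exact: rmorphM. Qed.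

Lemma counit_antipode h : counit (antipode h) = counit h.
Proof.
have := congr1 (fun x : H => counit x) (antipodel h).
rewrite linearZ /= rmorph1 tlift_comp; last exact: linearP.
rewrite [RHS]mulr1 => <-; rewrite -[in LHS](counitr h) !tlift_comp; try by lin.
by apply: eq_tlift => x y; rewrite rmorphM !linearZ /= mulrC.
Qed.

Lemma antipode1 : antipode (1 : H) = 1.
Proof.
have := antipodel (1 : H); rewrite rmorph1 -tens1 tlift_tens; last by bilin.
by rewrite mulr1 rmorph1 scale1r.
Qed.

(** Two divisions, each in a single variable.  For fixed [x],
    [F(y) = S(x1 y) x2] satisfies [F * id = eps(x) eps], so
    [S(x1 y) x2 = eps(x) S(y)].  This says in turn that, for fixed [y], the map
    [x |-> S(x y)] convolved with [id] gives [eps(x) S(y)]. *)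
Lemma antipodeM x y : antipode (x * y) = antipode y * antipode x.
Proof.
pose m := tlift (fun a b : H => antipode a * b).
have mE a b : m (a *t b) = antipode a * b by rewrite /m tlift_tens //; bilin.
have mM t b : m (t * (1 *t b)) = m t * b.
  rewrite /m; tensor_ext t => c d; rewrite tensM -/m !mE mulr1.
  exact: mulrA.
pose F z y := m (comul z * (y *t 1)).
have Fl z : linear (F z) by move=> c u v; rewrite /F /m; lincomb.
have FE z : F z =1 fun h => (counit z : k) *: antipode h.
  have Fid h : conv (F z) id h = (counit h : k) *: (counit z : k)%:A.
    transitivity (m (comul z * comul h)).
      rewrite /conv /F /m; move: (comul h) => s.
      tensor_ext s => c d; rewrite tlift_tens; last by bilin.
      by rewrite -/m -mM -mulrA tensM mulr1 mul1r.
    by rewrite -rmorphM [LHS]antipodel rmorphM /= scalerA mulrC.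
  move=> h; rewrite (conv_div _ _ _ Fid conv_antipoder) //; try exact: linearP.
  by rewrite conv_counitl ?mulr_algl //; exact: linearP.
have Gid h : conv (fun x => antipode (x * y)) id h = (counit h : k) *: antipode y.
  rewrite -FE /F /conv; move: (comul h) => t; rewrite /m.
  tensor_ext t => a b; rewrite tensM mulr1 !tlift_tens //; bilin.
rewrite (conv_div _ _ _ Gid conv_antipoder) //; try lin.
by rewrite conv_counitl //; exact: linearP.
Qed.

(** Let [j1(x) = x (x) 1] and [j2(x) = 1 (x) x], so that [Delta = j1 * j2] for
    convolution.  Both [Delta o S] and [(j2 o S) * (j1 o S)] are then inverse to
    [Delta], because composing an algebra map with [S] inverts it. *)
Lemma comul_antipode h :
  comul (antipode h) = tmap antipode antipode (tflip (comul h)).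
Proof.
pose j1 x : tensor H H := x *t 1; pose j2 x : tensor H H := 1 *t x.
have j1l : linear j1 by move=> c u v; rewrite /j1; lincomb.
have j2l : linear j2 by move=> c u v; rewrite /j2; lincomb.
have DE : comul =1 conv j1 j2.
  move=> x; rewrite /conv /j1 /j2; move: (comul x) => t; tensor_ext t => a b.
  by rewrite tlift_tens ?tensM ?mulr1 ?mul1r //; bilin.
pose s1 x := j1 (antipode x); pose s2 x := j2 (antipode x).
have s1l : linear s1 by move=> c u v; rewrite /s1 /j1; lincomb.
have s2l : linear s2 by move=> c u v; rewrite /s2 /j2; lincomb.
have inv_j1 : conv j1 s1 =1 fun h => (counit h : k)%:A.
  move=> x; transitivity (j1 (counit x : k)%:A); last first.
    by rewrite (linear_mapZ j1l) /j1 tens1.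
  rewrite -antipoder tlift_comp //; apply: eq_tlift => a b.
  by rewrite tensM mulr1.
have inv_j2 : conv j2 s2 =1 fun h => (counit h : k)%:A.
  move=> x; transitivity (j2 (counit x : k)%:A); last first.
    by rewrite (linear_mapZ j2l) /j2 tens1.
  rewrite -antipoder tlift_comp //; apply: eq_tlift => a b.
  by rewrite tensM mulr1.
pose DS x := comul (antipode x).
have DSl : linear DS by move=> c u v; rewrite /DS; lincomb.
have inv_DS : conv DS comul =1 fun h => (counit h : k)%:A.
  move=> x; rewrite /DS; transitivity (comul (counit x : k)%:A : tensor H H).
    rewrite -antipodel tlift_comp; last by lin.
    by apply: eq_tlift => a b; rewrite rmorphM.
  by rewrite linearZZ rmorph1.
have DSj1 : conv DS j1 =1 s2.
  have DSj : conv (conv DS j1) j2 =1 fun h => (counit h : k)%:A.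
    by move=> x; rewrite -convA // -(eq_conv (frefl DS) DE) inv_DS.
  move=> x; rewrite (conv_div _ _ _ DSj inv_j2) //; last exact: conv_linear.
  by rewrite conv_counitl // mul1r.
rewrite -[LHS]/(DS h) (conv_div _ _ _ DSj1 inv_j1) // /conv /s1 /s2 /j1 /j2.
move: (comul h) => t; tensor_ext t => a b.
rewrite tflipE tmapE ?tlift_tens; [| bilin].
by rewrite tensM mulr1 mul1r.
Qed.
End AntipodeTheory.

(** * R-matrices *)

Section TensorFlip.
Variables (k : fieldType) (A B : falgType k).

Lemma tflipM (s t : tensor A B) : tflip (s * t) = tflip s * tflip t.
Proof. by tensor_ext s => a b; tensor_ext t => c d; rewrite !(tensM, tflipE). Qed.

Lemma tflip1 : tflip (1 : tensor A B) = 1.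
Proof. exact: tflipE. Qed.

End TensorFlip.

Lemma tflipK (k : fieldType) (U V : vectType k) : cancel (@tflip k U V) (@tflip k V U).
Proof. by move=> t; tensor_ext t => a b; rewrite !tflipE. Qed.

Section Legs.
Variables (k : fieldType) (H : hopfAlgType k).
Implicit Types (s t : tensor H H) (x y : H).

Lemma leg13E x y : leg13 (x *t y) = (x *t 1) *t y.
Proof. by apply: tlift_tens; bilin. Qed.

Lemma leg23E x y : leg23 (x *t y) = (1 *t x) *t y.
Proof. by apply: tlift_tens; bilin. Qed.

Lemma leg12E x y : leg12 (x *t y) = (x *t y) *t 1.
Proof. by []. Qed.

Lemma leg12M s t : leg12 (s * t) = leg12 s * leg12 t.
Proof. by rewrite /leg12 tensM mulr1. Qed.

Lemma tmapSM s t : tmap antipode antipode (s * t) =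
  tmap antipode antipode t * tmap antipode antipode s.
Proof.
tensor_ext s => a b; tensor_ext t => c d.
by rewrite !(tensM, tmapE) ?antipodeM.
Qed.
End Legs.

Section RMatrix.
Variables (k : fieldType) (H : hopfAlgType k) (R : tensor H H).
Hypothesis qtR : quasitriangular R.
Implicit Types (s t : tensor H H) (x y : H).

(** Applying [eps] to the first leg of [(Delta (x) id) R = R13 R23] gives
    [R = (1 (x) e) R] with [e = (eps (x) id) R], and [R] is invertible. *)
Lemma counitl_Rmatrix : tlift (fun x y : H => (counit x : k) *: y) R = 1.
Proof.
pose el := tlift (fun x y : H => (counit x : k) *: y).
pose E := tlift3 (fun a b c : H => (counit a : k) *: (b *t c)).
have El s : E (tmap comul idfun s) = s.
  rewrite /E; tensor_ext s => a b; rewrite tmapE.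
  rewrite tlift3E; last by trilin.
  rewrite -[in RHS](counitl a) (@tlift_comp _ _ _ _ _ (fun z => z *t b)); last by lin.
  by apply: eq_tlift => x y; rewrite tensZl.
have Er s t : E (leg13 s * leg23 t) = (1 *t el s) * t.
  rewrite /E /el; tensor_ext s => a b; tensor_ext t => c d.
  rewrite leg13E leg23E !tensM mul1r mulr1 tlift3E; last by trilin.
  rewrite !tlift_tens; [|bilin|bilin].
  by rewrite -scalerAl tensZr.
have := El R; rewrite Rmatrix_comull // Er => eR.
have : 1 *t el R = 1 :> tensor H H.
  by apply: (mulIr (Rmatrix_unit qtR)); rewrite mul1r.
move/(congr1 el); rewrite -tens1 /el !tlift_tens; [|bilin|bilin].
by rewrite rmorph1 !scale1r.
Qed.

Lemma counitr_Rmatrix : tlift (fun x y : H => (counit y : k) *: x) R = 1.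
Proof.
pose er := tlift (fun x y : H => (counit y : k) *: x).
pose E := tlift3 (fun a b c : H => (counit c : k) *: (a *t b)).
have El s : E (tassoc (tmap idfun comul s)) = s.
  rewrite /E; tensor_ext s => a b; rewrite tmapE.
  rewrite tlift3_tassoc; last by trilin.
  rewrite -[in RHS](counitr b) (@tlift_comp _ _ _ _ _ (fun z => a *t z)); last by lin.
  by apply: eq_tlift => x y; rewrite tensZr.
have Er s t : E (leg13 s * leg12 t) = (er s *t 1) * t.
  rewrite /E /er; tensor_ext s => a b; tensor_ext t => c d.
  rewrite leg13E leg12E !tensM mul1r mulr1 tlift3E; last by trilin.
  rewrite !tlift_tens; [|bilin|bilin].
  by rewrite -scalerAl tensZl.
have := El R; rewrite Rmatrix_comulr // Er => eR.
have : er R *t 1 = 1 :> tensor H H.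
  by apply: (mulIr (Rmatrix_unit qtR)); rewrite mul1r.
move/(congr1 er); rewrite -tens1 /er !tlift_tens; [|bilin|bilin].
by rewrite rmorph1 !scale1r.
Qed.

(** Multiplying the first two legs of [(Delta (x) id) R = R13 R23] after applying
    [S] to the first one. *)
Lemma Rmatrix_inv : R^-1 = tmap antipode idfun R.
Proof.
apply: (mulIr (Rmatrix_unit qtR)); rewrite mulVr ?(Rmatrix_unit qtR) //.
pose E := tlift3 (fun a b c : H => (antipode a * b) *t c).
have El s : E (tmap comul idfun s) = 1 *t tlift (fun x y : H => (counit x : k) *: y) s.
  rewrite /E; tensor_ext s => a b; rewrite tmapE.
  rewrite tlift3E ?tlift_tens; [|bilin|trilin].
  rewrite tensZr -tensZl -antipodel.
  by rewrite (@tlift_comp _ _ _ _ _ (fun z => z *t b)) //; lin.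
have Er s t : E (leg13 s * leg23 t) = tmap antipode idfun s * t.
  rewrite /E; tensor_ext s => a b; tensor_ext t => c d.
  rewrite leg13E leg23E !tensM mul1r mulr1 tlift3E; last by trilin.
  by rewrite tmapE tlift_tens ?tensM //; bilin.
by rewrite -Er -Rmatrix_comull // El counitl_Rmatrix.
Qed.

(** Applied to both sides of [(id (x) Delta) R = R13 R12], the map
    [a (x) b (x) c |-> S(a) (x) S(b) c] gives [1 = (S (x) S)(R) R^-1]: as [S]
    reverses products, the two copies of [R] exchange their order. *)
Lemma Rmatrix_antipode : tmap antipode antipode R = R.
Proof.
have unitR := Rmatrix_unit qtR.
apply: (mulIr (_ : R^-1 \is a GRing.unit)); rewrite ?unitrV // mulrV //.
pose E := tlift3 (fun a b c : H => antipode a *t (antipode b * c)).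
have El s : E (tassoc (tmap idfun comul s)) =
    antipode (tlift (fun x y : H => (counit y : k) *: x) s) *t 1.
  rewrite /E; tensor_ext s => a b; rewrite tmapE.
  rewrite tlift3_tassoc ?tlift_tens; [|bilin|trilin].
  rewrite linearZZ tensZl -tensZr -antipodel.
  by rewrite [RHS](@tlift_comp _ _ _ _ _ (fun z => antipode a *t z)) //; lin.
have Er s t : E (leg13 s * leg12 t) = tmap antipode antipode t * tmap antipode idfun s.
  rewrite /E; tensor_ext s => a b; tensor_ext t => c d.
  rewrite leg13E leg12E !tensM mul1r mulr1 tlift3E; last by trilin.
  rewrite !tmapE ?tlift_tens ?tensM ?antipodeM //; bilin.
by rewrite Rmatrix_inv -Er -Rmatrix_comulr // El counitr_Rmatrix antipode1.
Qed.

(** Quasi-cocommutativity, applied to the first legs of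
    [(Delta (x) id) R = R13 R23]. *)
Lemma yang_baxter : leg12 R * leg13 R * leg23 R = leg23 R * leg13 R * leg12 R.
Proof.
rewrite -mulrA -Rmatrix_comull //.
have op s : tmap (@tflip k H H) idfun (tmap comul idfun s) * leg12 R =
    leg12 R * tmap comul idfun s.
  tensor_ext s => a b; by rewrite !tmapE /leg12 ?tensM ?Rmatrix_op ?mulr1 ?mul1r.
have flip13 s t : tmap (@tflip k H H) idfun (leg13 s * leg23 t) = leg23 s * leg13 t.
  tensor_ext s => a b; tensor_ext t => c d.
  rewrite !(leg13E, leg23E, tensM) tmapE.
  by rewrite !(mul1r, mulr1); congr (_ *t _); exact: tflipE.
by rewrite -op Rmatrix_comull // flip13.
Qed.
End RMatrix.

(** * The Drinfeld element *)

Section DrinfeldMap.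
Variables (k : fieldType) (H : hopfAlgType k).
Implicit Types (s t : tensor H H) (x y h : H).

Lemma drinfeldE x y : drinfeld (x *t y) = antipode y * x.
Proof. by apply: tlift_tens; bilin. Qed.

(** [drinfeld] is defined on all tensors, and its behaviour under multiplication
    by [Delta^op(h)] on the left and by [Delta(h)] on the right is what transfers
    the relation [Delta^op(h) R = R Delta(h)] to the Drinfeld element. *)
Lemma drinfeld_opl h t :
  drinfeld (tflip (comul h) * t) = (counit h : k) *: drinfeld t.
Proof.
rewrite /drinfeld; tensor_ext t => a b; rewrite -!/(drinfeld _).
have opl s : drinfeld (tflip s * (a *t b)) =
    antipode b * tlift (fun x y => antipode x * y) s * a.
  rewrite /drinfeld; tensor_ext s => x y; rewrite -/(drinfeld _).
  rewrite tflipE tensM drinfeldE antipodeM tlift_tens; last by bilin.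
  by rewrite !mulrA.
by rewrite opl antipodel drinfeldE -scalerAr mulr1 -scalerAl.
Qed.

Lemma drinfeld_opr s t :
  drinfeld (t * s) = tlift (fun x y => antipode y * drinfeld t * x) s.
Proof.
rewrite [LHS]/drinfeld; tensor_ext s => x y; rewrite -/(drinfeld _).
rewrite tlift_tens /drinfeld; last by bilin.
tensor_ext t => a b; rewrite -!/(drinfeld _).
by rewrite tensM !drinfeldE antipodeM !mulrA.
Qed.

End DrinfeldMap.

Section DrinfeldElement.
Variables (k : fieldType) (H : hopfAlgType k) (R : tensor H H).
Hypothesis qtR : quasitriangular R.
Implicit Types (s t : tensor H H) (x y h : H).
Local Notation u := (drinfeld R).

Lemma drinfeld_adjoint h :
  tlift (fun x y => antipode y * u * x) (comul h) = (counit h : k) *: u.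
Proof. by rewrite -drinfeld_opr -Rmatrix_op // drinfeld_opl. Qed.

(** Compute [S^2(h3) S(h2) u h1] in two ways.  Grouping [S^2(h3) S(h2)] as
    [S(h2 S(h3))] gives [u h]; grouping [S(h2) u h1] and using
    [drinfeld_adjoint] gives [S^2(h) u]. *)
Lemma mul_drinfeld h : u * h = antipode (antipode h) * u.
Proof.
pose f x y z := antipode (antipode z) * (antipode y * u * x).
have f3 : trilinear f by rewrite /f; trilin.
transitivity (tlift (fun x y => tlift (f x) (comul y)) (comul h)).
  rewrite -[in LHS](counitr h) (@tlift_comp _ _ _ _ _ (fun z => u * z)); last by lin.
  apply: eq_tlift => x y.
  transitivity (antipode (tlift (fun a b => a * antipode b) (comul y)) * (u * x)).
    rewrite antipoder linearZZ antipode1 -scalerAl mul1r.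
    by rewrite scalerAr.
  rewrite /f; move: (comul y) => t; tensor_ext t => a b.
  by rewrite !tlift_tens ?antipodeM ?mulrA //; bilin.
rewrite (sweedlerA _ f3) -[in RHS](counitl h).
rewrite [RHS](@tlift_comp _ _ _ _ _ (fun z => antipode (antipode z) * u)); last by lin.
apply: eq_tlift => x z; rewrite !linearZZ -scalerAl scalerAr -drinfeld_adjoint.
by rewrite [RHS](@tlift_comp _ _ _ _ _ (fun v => antipode (antipode z) * v)) //; lin.
Qed.

Lemma tlift_Rmatrix (W : lmodType k) (f : H -> H -> W) : bilinear2 f ->
  tlift f R = tlift (fun x y => f (antipode x) (antipode y)) R.
Proof. by move=> f2; rewrite -{1}(Rmatrix_antipode qtR) tlift_tmap. Qed.

(** This will turn out to be the inverse of [u]. *)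
Let w := tlift (fun x y => y * antipode (antipode x)) R.

Let w_drinfeld : w * u = 1.
Proof.
transitivity (tlift (fun x y => y * u * x) R).
  rewrite (@tlift_comp _ _ _ _ _ (fun z => z * u)); last by lin.
  by apply: eq_tlift => x y; rewrite -[RHS]mulrA mul_drinfeld mulrA.
rewrite tlift_Rmatrix; last by bilin.
transitivity (drinfeld (R * tmap antipode idfun R)).
  by rewrite drinfeld_opr tlift_tmap //; bilin.
by rewrite -Rmatrix_inv // mulrV ?(Rmatrix_unit qtR) // drinfeldE mulr1 antipode1.
Qed.

(** The left inverse [w] is fixed by [S^2], as [R] is fixed by [S (x) S], so
    [u w = S^2(w) u = w u = 1]. *)
Lemma drinfeld_unit : u \is a GRing.unit.
Proof.
suff uw : u * w = 1 by apply/unitrP; exists w.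
have S2w : antipode (antipode w) = w.
  rewrite !tlift_comp; [|lin|lin]; rewrite [in RHS]/w [RHS]tlift_Rmatrix; last by bilin.
  rewrite [RHS]tlift_Rmatrix; last by bilin.
  by apply: eq_tlift => x y; rewrite !antipodeM.
by rewrite mul_drinfeld S2w w_drinfeld.
Qed.

Lemma counit_drinfeld : counit u = 1.
Proof.
rewrite /drinfeld tlift_comp; last by lin.
transitivity (counit (tlift (fun x y : H => (counit x : k) *: y) R)).
  rewrite tlift_comp; last by lin.
  apply: eq_tlift => x y; rewrite counitM counit_antipode linearZ /=. exact: mulrC.
by rewrite counitl_Rmatrix // rmorph1.
Qed.

(** The coproduct of [u], writing [R = x (x) y].  As
    [(Delta (x) id) R = R13 R23], [Delta(u)] is [Q (P R) R], two nested sums over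
    copies of [R].  Expanding [Delta(S(y))] with [(id (x) Delta) R = R13 R12]
    gives [P R = (u (x) 1) T]; expanding it in [Q] as well brings in a third copy
    of [R] and shows that [Delta(u)] is [u (x) 1] times the image under [L] of
    [R12^-1 R23 R13].  By the Yang-Baxter equation this product equals
    [R13 R23 R12^-1], whose image under [L] splits into three factors, one for
    each copy. *)
Local Notation T := (tmap idfun antipode R).
Let P s := tlift (fun x y => comul (antipode y) * (x *t 1)) s.

Let P_Rmatrix : P R = (u *t 1) * T.
Proof.
pose G := tlift3 (fun a b c : H => (antipode c * a) *t antipode b).
have Gl s : G (tassoc (tmap idfun comul s)) = P s.
  rewrite /G /P; tensor_ext s => a b; rewrite tmapE tlift3_tassoc; last by trilin.
  rewrite tlift_tens; last by bilin.
  rewrite comul_antipode /=; move: (comul b) => t; tensor_ext t => c d.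
  by rewrite tflipE tmapE tensM mulr1 tlift_tens //; bilin.
have Gr s t : G (leg13 s * leg12 t) = (drinfeld s *t 1) * tmap idfun antipode t.
  rewrite /G /drinfeld; tensor_ext s => a b; tensor_ext t => c d.
  rewrite leg13E leg12E !tensM mul1r mulr1 tlift3E; last by trilin.
  by rewrite tmapE !tlift_tens ?tensM ?mul1r ?mulrA //; bilin.
by rewrite -Gl Rmatrix_comulr // Gr.
Qed.

Let Q X s := tlift (fun x y => comul (antipode y) * X * (1 *t x)) s.

Let comul_drinfeld_sum : comul u = Q (P R) R.
Proof.
pose G := tlift3 (fun a b c : H => comul (antipode c) * (a *t b)).
have Gl s : G (tmap comul idfun s) = comul (drinfeld s).
  rewrite /G /drinfeld; tensor_ext s => a b; rewrite tmapE /= tlift3E; last by trilin.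
  rewrite tlift_tens ?comulM; last by bilin.
  move: (comul a) => t; tensor_ext t => c d; rewrite tlift_tens //; bilin.
have Gr s t : G (leg13 s * leg23 t) = Q (P s) t.
  rewrite /G /Q /P; tensor_ext s => a b; tensor_ext t => c d.
  rewrite leg13E leg23E !tensM mul1r mulr1 tlift3E; last by trilin.
  rewrite !tlift_tens; try bilin.
  by rewrite antipodeM comulM -!mulrA tensM mulr1 mul1r.
by rewrite -Gl Rmatrix_comull // Gr.
Qed.

Let L := tlift3 (fun a c b : H => c *t (antipode b * a)).

Let conj_antipode s := tlift (fun x y => x *t (u^-1 * antipode y * u)) s.

(* As [R] is fixed by [S (x) S], the second leg becomes [u^-1 S^2(y) u = y] and
   the first one [S(x)]. *)
Let conj_antipodeR : conj_antipode R = R^-1.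
Proof.
rewrite /conj_antipode tlift_Rmatrix ?Rmatrix_inv; [|done|bilin].
by apply: eq_tlift => x y; rewrite -mulrA -mul_drinfeld mulKr ?drinfeld_unit.
Qed.

Let comul_drinfeld_legs :
  comul u = (u *t 1) * L (leg12 R^-1 * leg23 R * leg13 R).
Proof.
pose G r := tlift3 (fun a b c : H =>
  (antipode c *t antipode b) * ((u *t 1) * tmap idfun antipode r) * (1 *t a)).
have Gl r s : G r (tassoc (tmap idfun comul s)) = Q ((u *t 1) * tmap idfun antipode r) s.
  rewrite /G /Q; tensor_ext s => a b; rewrite tmapE /= tlift3_tassoc; last by trilin.
  rewrite tlift_tens; last by bilin.
  rewrite comul_antipode /=; move: (comul b) => t; tensor_ext t => c d.
  by rewrite tflipE tmapE tlift_tens //; bilin.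
have Gr s t r : G r (leg13 s * leg12 t) =
    (u *t 1) * L (leg12 (conj_antipode s) * leg23 r * leg13 t).
  rewrite /G /L /conj_antipode.
  tensor_ext s => a b; tensor_ext t => c d.
  rewrite (leg13E a) (leg12E c) !tensM mul1r mulr1 tlift3E; last by trilin.
  rewrite !tlift_tens; try bilin.
  tensor_ext r => p q.
  rewrite leg12E leg23E leg13E !tensM !mul1r !mulr1 tlift3E; last by trilin.
  rewrite tlift_tens; last by bilin.
  by rewrite tmapE !tensM !mul1r !mulr1 antipodeM !mulrA mulrV ?drinfeld_unit // mul1r.
by rewrite comul_drinfeld_sum P_Rmatrix -Gl Rmatrix_comulr // Gr conj_antipodeR.
Qed.

Let legs_swap : leg12 R^-1 * leg23 R * leg13 R = leg13 R * leg23 R * leg12 R^-1.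
Proof.
have legK : leg12 R^-1 * leg12 R = 1 by rewrite -leg12M mulVr ?(Rmatrix_unit qtR).
have legVK : leg12 R * leg12 R^-1 = 1 by rewrite -leg12M mulrV ?(Rmatrix_unit qtR).
rewrite -[RHS]mul1r -legK -!mulrA (mulrA (leg12 R)) (mulrA _ _ (leg12 R^-1)).
by rewrite yang_baxter // -!mulrA legVK mulr1.
Qed.

Let L_legs s t r :
  L (leg13 s * leg23 t * leg12 r) =
  tmap idfun antipode t * (1 *t drinfeld s) * tflip r.
Proof.
rewrite /L /drinfeld.
tensor_ext s => a b; tensor_ext t => c d; tensor_ext r => p q.
rewrite leg12E leg23E leg13E !tensM !mul1r !mulr1 tlift3E; last by trilin.
rewrite !tlift_tens; try bilin.
by rewrite tmapE tflipE !tensM mulr1 antipodeM !mulrA.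
Qed.

Let mul_T : T * (1 *t u) = (1 *t u) * R^-1.
Proof.
rewrite Rmatrix_inv //; rewrite {1}/tmap tlift_Rmatrix; last by bilin.
rewrite (@tlift_comp _ _ _ _ _ (fun z => z * (1 *t u))); last by lin.
rewrite (@tlift_comp _ _ _ _ _ (fun z => (1 *t u) * z)); last by lin.
by apply: eq_tlift => x y; rewrite !tensM mulr1 mul1r mul_drinfeld.
Qed.

Lemma tflip_unit : tflip R \is a GRing.unit.
Proof.
apply/unitrP; exists (tflip R^-1).
by rewrite -!tflipM mulVr ?mulrV ?(Rmatrix_unit qtR) // tflip1.
Qed.

Lemma tflipV : tflip R^-1 = (tflip R)^-1.
Proof.
apply: (mulrI tflip_unit).
by rewrite -tflipM !mulrV ?tflip_unit ?(Rmatrix_unit qtR) // tflip1.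
Qed.

Lemma comul_drinfeld : comul u = (u *t u) * (tflip R * R)^-1.
Proof.
rewrite comul_drinfeld_legs legs_swap L_legs mul_T tflipV.
by rewrite invrM ?tflip_unit ?(Rmatrix_unit qtR) // !mulrA tensM mulr1 mul1r.
Qed.
End DrinfeldElement.

(** * Group-like and central elements *)

Lemma tensV (k : fieldType) (A B : falgType k) (x : A) (y : B) :
    x \is a GRing.unit -> y \is a GRing.unit ->
  (x *t y) \is a GRing.unit /\ (x *t y)^-1 = x^-1 *t y^-1.
Proof.
move=> Ux Uy.
have VK : (x^-1 *t y^-1) * (x *t y) = 1 by rewrite tensM !mulVr // tens1.
have KV : (x *t y) * (x^-1 *t y^-1) = 1 by rewrite tensM !mulrV // tens1.
have U : (x *t y) \is a GRing.unit by apply/unitrP; exists (x^-1 *t y^-1).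
by split=> //; apply: (mulrI U); rewrite KV mulrV.
Qed.

Section Grouplike.
Variables (k : fieldType) (H : hopfAlgType k).
Implicit Types g h : H.

Lemma grouplike_counit g : grouplike g -> counit g = 1.
Proof.
case=> g0 Dg; have := counitl g; rewrite Dg tlift_tens; last by bilin.
move=> /eqP; rewrite -subr_eq0 -[X in _ - X]scale1r -scalerBl scaler_eq0.
by rewrite (negPf g0) orbF subr_eq0 => /eqP.
Qed.

Lemma antipode_grouplikeK g : grouplike g ->
  antipode g * g = 1 /\ g * antipode g = 1.
Proof.
move=> gl; have [_ Dg] := gl; have := antipodel g; have := antipoder g.
by rewrite Dg !tlift_tens ?grouplike_counit ?scale1r; [split|..]; try bilin.
Qed.

Lemma grouplike_unit g : grouplike g -> g \is a GRing.unit.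
Proof. by case/antipode_grouplikeK=> gl gr; apply/unitrP; exists (antipode g). Qed.

Lemma antipode_grouplike g : grouplike g -> antipode g = g^-1.
Proof.
move=> gg; apply: (mulIr (grouplike_unit gg)).
by rewrite mulVr ?grouplike_unit ?(antipode_grouplikeK gg).1.
Qed.

Lemma unit_grouplike g : g \is a GRing.unit -> comul g = g *t g -> grouplike g.
Proof. by move=> Ug Dg; split=> //; apply: contraTneq Ug => ->; rewrite unitr0. Qed.

Lemma grouplike1 : grouplike (1 : H).
Proof. by apply: unit_grouplike; rewrite ?unitr1 ?rmorph1. Qed.

Lemma grouplikeM g h : grouplike g -> grouplike h -> grouplike (g * h).
Proof.
move=> gg gh; apply: unit_grouplike; first by rewrite unitrMl grouplike_unit.
by rewrite comulM gg.2 gh.2 tensM.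
Qed.

Lemma grouplikeV g : grouplike g -> grouplike g^-1.
Proof.
move=> gg; have Ug := grouplike_unit gg.
apply: unit_grouplike; first by rewrite unitrV.
by rewrite -(tensV Ug Ug).2 -gg.2; exact: rmorphV.
Qed.

Lemma grouplikeX g m : grouplike g -> grouplike (g ^+ m).
Proof.
move=> gg; elim: m => [|m IHm]; first exact: grouplike1.
by rewrite exprS; exact: grouplikeM.
Qed.

Lemma centralP (z : H) : central z <-> forall h, z * h = h * z.
Proof.
rewrite /central memv_cap memvf /=; split=> [/centvP zc h|zc].
  by apply: zc; exact: memvf.
by apply/centvP=> h _; exact: zc.
Qed.

(** The centralizer of [z] is a subalgebra. *)
Lemma central_gen (n : nat) (a : n.-tuple H) (z : H) :
    agenv <<a>>%VS = fullv -> (forall i, z * tnth a i = tnth a i * z) ->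
  central z.
Proof.
move=> ga za; apply/centralP=> h.
suff /subvP/(_ h (memvf h))/cent1vP-> : (fullv <= 'C[z])%VS by [].
rewrite -ga; apply: agenv_sub_modl; first by rewrite -memvE cent1v1.
apply/prodvP=> x y ax /cent1vP yz; apply/cent1vP.
suff /subvP/(_ _ ax)/cent1vP xz : (<<a>> <= 'C[z])%VS by rewrite -mulrA yz !mulrA xz.
by apply/span_subvP=> _ /tnthP[i ->]; apply/cent1vP; rewrite za.
Qed.

End Grouplike.

(** * Ribbon elements *)

Section RibbonElements.
Variables (k : fieldType) (H : hopfAlgType k) (R : tensor H H).
Hypothesis qtR : quasitriangular R.
Implicit Types (s t : tensor H H) (x y h : H).
Local Notation u := (drinfeld R).
Local Notation Uu := (drinfeld_unit qtR).
Local Notation M := (tflip R * R).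

Lemma antipode_unit x : x \is a GRing.unit -> antipode x \is a GRing.unit.
Proof.
by move=> Ux; apply/unitrP; exists (antipode x^-1);
  rewrite -!antipodeM mulrV // mulVr // antipode1.
Qed.

Lemma antipode2_drinfeld : antipode (antipode u) = u.
Proof. by apply: (mulIr Uu); rewrite -mul_drinfeld. Qed.

Lemma drinfeld_comm : u * antipode u = antipode u * u.
Proof. by rewrite mul_drinfeld // antipode2_drinfeld. Qed.

(** This is [S] applied to [u y = S^2(y) u]; it covers every [h] because [S^2],
    being conjugation by [u], is surjective. *)
Lemma mul_antipode_drinfeld h :
  h * antipode u = antipode u * antipode (antipode h).
Proof.
pose y := u^-1 * h * u.
have hE : h = antipode (antipode y).
  by apply: (mulIr Uu); rewrite -mul_drinfeld // /y !mulrA mulrV ?Uu // mul1r.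
by rewrite [in LHS]hE -antipodeM mul_drinfeld // antipodeM -hE.
Qed.

Lemma tflip_antipode t :
  tmap antipode antipode (tflip t) = tflip (tmap antipode antipode t).
Proof. by tensor_ext t => a b; rewrite !(tflipE, tmapE). Qed.

Lemma monodromy_unit : M \is a GRing.unit.
Proof. by rewrite unitrMl ?(Rmatrix_unit qtR) ?tflip_unit. Qed.

(** Conjugation by [u (x) u] is [S^2 (x) S^2], which fixes [R]. *)
Lemma monodromy_comm : (u *t u) * M = M * (u *t u).
Proof.
have S2 t : (u *t u) * t =
    tmap antipode antipode (tmap antipode antipode t) * (u *t u).
  by tensor_ext t => a b; rewrite !tmapE !tensM !mul_drinfeld.
by rewrite S2 !tmapSM !(tflip_antipode, Rmatrix_antipode qtR).
Qed.

(** Applying [S] to [u] reverses the product and flips the coproduct; the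
    resulting antiautomorphism [F] fixes [R21 R]. *)
Lemma comul_antipode_drinfeld :
  comul (antipode u) = M^-1 * (antipode u *t antipode u).
Proof.
apply: (mulrI monodromy_unit); rewrite mulrA mulrV ?monodromy_unit // mul1r.
pose F (t : tensor H H) := tmap antipode antipode (tflip t).
have FM s t : F (s * t) = F t * F s by rewrite /F tflipM tmapSM.
have F1 : F 1 = 1 by rewrite /F tflip1 -tens1 tmapE /= antipode1.
have FMon : F M = M by rewrite FM /F tflipK tflip_antipode !Rmatrix_antipode.
rewrite comul_antipode comul_drinfeld // -/(F _) FM mulrA -{1}FMon -FM.
by rewrite mulVr ?monodromy_unit // F1 mul1r /F tflipE tmapE.
Qed.

Definition drinfeld_grouplike := (antipode u)^-1 * u.

(** The factors [R21 R] in the coproducts of [u] and of [S(u)^-1] cancel. *)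
Lemma drinfeld_grouplikeP : grouplike drinfeld_grouplike.
Proof.
have USu := antipode_unit Uu; have [USS SSV] := tensV USu USu.
apply: unit_grouplike; first by rewrite unitrMl ?unitrV ?USu ?Uu.
have DV : comul (antipode u)^-1 = ((antipode u)^-1 *t (antipode u)^-1) * M.
  rewrite -SSV -[M]invrK -invrM ?unitrV ?monodromy_unit //.
  by rewrite -comul_antipode_drinfeld; exact: rmorphV.
rewrite comulM comul_drinfeld // DV -tensM -[LHS]mulrA; congr (_ * _).
by rewrite mulrA -monodromy_comm mulrK ?monodromy_unit.
Qed.

Lemma mul_drinfeld_grouplike h :
  drinfeld_grouplike * h = antipode (antipode (antipode (antipode h))) * drinfeld_grouplike.
Proof.
have USu := antipode_unit Uu.
apply: (mulrI USu); rewrite /drinfeld_grouplike !mulrA mulrV // mul1r mul_drinfeld //.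
by rewrite -mul_antipode_drinfeld mulrK.
Qed.

(** As [S^2(l) = l], [u] commutes with [l], hence also with [g]; so [S(u) = u g^-1]
    gives [v^2 = u^2 g^-1 = u S(u)] and [S(v) = S(u) l = l^-1 u]. *)
Lemma ribbon_of_sqrt l : grouplike l -> l * l = drinfeld_grouplike ->
  central (l^-1 * u) -> ribbon R (l^-1 * u).
Proof.
move=> gl ll zv; have Ul := grouplike_unit gl.
have gV := grouplikeV gl; have Sl := antipode_grouplike gl.
have SlV : antipode l^-1 = l by rewrite antipode_grouplike // invrK.
have lu : u * l^-1 = l^-1 * u by rewrite mul_drinfeld // SlV Sl.
have lu' : u * l = l * u by rewrite mul_drinfeld // Sl SlV.
have Su : l * l * antipode u = u.
  rewrite ll -mulrA drinfeld_comm mulrA mulVr ?mul1r //.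
  exact: antipode_unit Uu.
have Su' : antipode u = l^-1 * l^-1 * u.
  by rewrite -[in RHS]Su -!mulrA !mulKr.
split=> //.
- by rewrite expr2 Su' !mulrA lu -!mulrA (mulrA u) lu !mulrA.
- by rewrite antipodeM SlV Su' -!mulrA lu' mulKr.
- by rewrite counitM (grouplike_counit gV) counit_drinfeld // mulr1.
- by rewrite comulM gV.2 comul_drinfeld // mulrA tensM.
Qed.

Lemma ribbon_unit v : ribbon R v -> v \is a GRing.unit.
Proof.
move=> rv; rewrite -(unitrX_pos v (isT : 0 < 2)%N) (ribbon_sqr rv).
by rewrite unitrMl ?Uu // antipode_unit ?Uu.
Qed.

(** In the coproduct of [v v'^-1] the two factors [(R21 R)^-1] cancel, so this
    quotient is group-like; it is central because [v] and [v'] are. *)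
Lemma ribbon_unique v v' : (forall g : H, grouplike g -> central g -> g = 1) ->
  ribbon R v -> ribbon R v' -> v = v'.
Proof.
move=> GZ rv rv'; have Uv := ribbon_unit rv; have Uv' := ribbon_unit rv'.
have [UVV VVV] := tensV Uv' Uv'.
have DV : comul v'^-1 = M * (v'^-1 *t v'^-1).
  rewrite -VVV -[M]invrK -invrM ?unitrV ?monodromy_unit //.
  by rewrite -(ribbon_comul rv'); exact: rmorphV.
have zv := (centralP v).1 (ribbon_central rv).
have zv' := (centralP v').1 (ribbon_central rv').
suff : v * v'^-1 = 1 by move/(congr1 ( *%R^~ v')); rewrite mulrVK // mul1r.
apply: GZ.
  apply: unit_grouplike; first by rewrite unitrMl ?unitrV.
  rewrite comulM (ribbon_comul rv) DV -tensM -[LHS]mulrA; congr (_ * _).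
  by rewrite mulKr ?monodromy_unit.
apply/centralP=> h; rewrite [RHS]mulrA -zv -!mulrA; congr (_ * _).
by apply: (mulrI Uv'); rewrite mulVKr // mulrA zv' mulrK.
Qed.
End RibbonElements.

Lemma odd_common_period (k : fieldType) n (lambda : 'I_n -> k) :
    (forall i, exists2 m, odd m & m.-primitive_root (lambda i)) ->
  exists2 N, odd N & forall i, lambda i ^+ N = 1.
Proof.
move=> /fin_all_exists2[m odd_m prim_m]; exists (\prod_i m i).
  by elim/big_ind: _ => // x y ox oy; rewrite oddM ox oy.
by move=> i; rewrite (bigD1 i) //= exprM (prim_expr_order (prim_m i)) expr1n.
Qed.

Lemma skew_commX (k : fieldType) (A : falgType k) (g x : A) c m :
  g * x = c *: (x * g) -> g ^+ m * x = c ^+ m *: (x * g ^+ m).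
Proof.
move=> gx; elim: m => [|m IHm]; first by rewrite !expr0 mul1r mulr1 scale1r.
rewrite [in LHS]exprS -mulrA IHm -scalerAr [g * _]mulrA gx -scalerAl scalerA.
by rewrite -mulrA -exprSr -exprS.
Qed.

Theorem proposition3p5 (k : closedFieldType) (char0 : [pchar k] =i pred0)
    (H : hopfAlgType k) (R : tensor H H) (qtR : quasitriangular R)
    (n : nat) (a : n.-tuple H) (gen_a : agenv <<a>>%VS = fullv)
    (GZ : forall g : H, (grouplike g /\ central g) <-> g = 1)
    (lambda : 'I_n -> k)
    (odd_lambda : forall i, exists2 m, odd m & m.-primitive_root (lambda i))
    (S2a : forall i,
       antipode (antipode (tnth a i)) = lambda i *: tnth a i) :
  exists! v : H, ribbon R v.
Proof.
have [N oddN lambdaN] := odd_common_period odd_lambda.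
(* The square root of [g] in the cyclic group of odd order it generates. *)
pose g := drinfeld_grouplike R; pose l := g ^+ N.+1./2.
have gg : grouplike g by exact: drinfeld_grouplikeP.
have gl : grouplike l by exact: grouplikeX.
have ga i : g * tnth a i = lambda i ^+ 2 *: (tnth a i * g).
  by rewrite mul_drinfeld_grouplike // !(S2a, linearZZ) scalerA -scalerAl.
have gN1 : g ^+ N = 1.
  apply/GZ; split; first exact: grouplikeX.
  apply: (central_gen gen_a) => i.
  by rewrite (skew_commX N (ga i)) -exprM mulnC exprM lambdaN expr1n scale1r.
have N2 : (N.+1./2 * 2 = N.+1)%N by rewrite muln2 -[RHS]odd_double_half /= oddN.
have ll : l * l = g by rewrite -expr2 -exprM N2 exprSr gN1 mul1r.
have la i : l * tnth a i = lambda i *: (tnth a i * l).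
  by rewrite (skew_commX _ (ga i)) -exprM mulnC N2 exprSr lambdaN mul1r.
have rv : ribbon R (l^-1 * drinfeld R).
  apply: ribbon_of_sqrt => //; apply: (central_gen gen_a) => i.
  apply: (mulrI (grouplike_unit gl)).
  rewrite !mulrA la mulrV ?grouplike_unit // mul1r mul_drinfeld // S2a.
  by rewrite -!scalerAl mulrK ?grouplike_unit.
exists (l^-1 * drinfeld R); split=> // v'; apply: ribbon_unique => // h gh zh.
by apply/GZ.
Qed.
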